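(* Let $G$ be a finite group, $P$ a $p$-subgroup of $G$, and $M=S(G,P)$. Assume $\mathcal{F}_P(G)$ is saturated. Let $R$ be a normal subgroup of $G$ with $R\le P\cap\ker(M)$, and let $\mathcal{A}=\{T\le P : R\le T \text{ and } T \text{ is a maximal subgroup of } P\}$. If $\mathrm{Res}^G_{C_G(T)} M$ is indecomposable for every $T\in\mathcal{A}$, then $M$ is Brauer indecomposable. Moreover, $\mathrm{core}_G(P)\le P\cap \ker(M)$, and every normal subgroup $R$ of $G$ with $R\le P\cap\ker(M)$ is contained in $\mathrm{core}_G(P)$.
   Context: Throughout, $p$ is a prime and $k$ is an algebraically closed field of characteristic $p$; all modules are finite dimensional. For a $kG$-module $M$, $\ker(M)=\{g\in G: gm=m \text{ for all } m\in M\}$. For $H\le G$, $S(G,H)$ denotes the Scott module: the unique indecomposable direct summand of $\mathrm{Ind}_H^G(k)$ (with $k$ the trivial module) containing the trivial $kG$-module in its socle (equivalently, in its head). For a $kG$-module $M$ and a $p$-subgroup $Q\le G$, the Brauer construction is $M(Q)=M^Q/\sum_{R<Q}\mathrm{Tr}_R^Q(M^R)$, a $kN_G(Q)$-module. $M$ is Brauer indecomposable if for every $p$-subgroup $Q\le G$, $\mathrm{Res}^{N_G(Q)}_{QC_G(Q)} M(Q)$ is indecomposable or zero. $\mathrm{core}_G(P)=\bigcap_{x\in G}xPx^{-1}$. $\mathcal{F}_P(G)$ is the fusion system on $P$ whose morphisms are the conjugation maps induced by elements of $G$; ''saturated'' is in the standard sense. *)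

(* Defs.v *)
From HB Require Import structures.
From mathcomp Require Import all_boot all_order all_algebra all_fingroup all_solvable.
From mathcomp Require Import mxrepresentation.
Set Implicit Arguments. Unset Strict Implicit. Unset Printing Implicit Defensive.
Import GRing.Theory.
Local Open Scope ring_scope.
Local Open Scope group_scope.

(* Conventions: modules are MathComp matrix representations
   rG : mx_representation F G n (right action on row vectors 'rV[F]_n).
   Subspaces of 'rV_n are represented by matrices (row spaces, %MS). *)

Section Modules.
Variables (F : fieldType) (gT : finGroupType).

Definition mx_stable n (r : gT -> 'M[F]_n) (H : {set gT}) (U : 'M[F]_n) :=
  forall x, x \in H -> (U *m r x <= U)%MS.

(* For H-stable subspaces T <= V, the H-module V/T is indecomposable:
   it is nonzero, and whenever V/T = A/T (+) B/T with A, B H-stable,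
   T <= A, B <= V, one summand is zero. *)
Definition subquot_indecomposable n (r : gT -> 'M[F]_n) (H : {set gT})
    (V T : 'M[F]_n) :=
  ~~ (V <= T)%MS /\
  forall A B : 'M[F]_n,
    mx_stable r H A -> mx_stable r H B ->
    (T <= A)%MS -> (A <= V)%MS -> (T <= B)%MS -> (B <= V)%MS ->
    (A :&: B <= T)%MS -> (V <= A + B)%MS ->
    (A <= T)%MS \/ (B <= T)%MS.

Definition mod_indecomposable n (r : gT -> 'M[F]_n) (H : {set gT}) :=
  subquot_indecomposable r H 1%:M 0.

Variables (G : {group gT}) (n : nat) (rG : mx_representation F G n).

Definition rel_trace_mx (R Q : {set gT}) : 'M[F]_n :=
  \sum_(x in transversal (rcosets R Q) Q) rG x.

Definition brauer_trace_space (Q : {group gT}) : 'M[F]_n :=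
  (\sum_(R : {group gT} | R \proper Q) (rfix_mx rG R *m rel_trace_mx R Q))%MS.

(* M(Q) = M^Q / sum_{R<Q} Tr_R^Q(M^R), restricted to Q C_G(Q),
   is indecomposable or zero. *)
Definition brauer_indecomposable (p : nat) :=
  forall Q : {group gT}, Q \subset G -> p.-group Q ->
    (rfix_mx rG Q <= brauer_trace_space Q)%MS \/
    subquot_indecomposable rG (Q * 'C_G(Q)) (rfix_mx rG Q) (brauer_trace_space Q).

End Modules.

Section Scott.
Variables (F : fieldType) (gT : finGroupType).

(* The permutation module k[P\G] = Ind_P^G(k), basis indexed by the
   right cosets of P in G, with g acting by right multiplication. *)
Definition perm_coset_mx (G P : {set gT}) (x : gT) : 'M[F]_#|rcosets P G| :=
  \matrix_(i, j) ((enum_val i :* x == enum_val j)%:R).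

(* M = S(G,P): M is isomorphic (via the injective G-homomorphism B)
   to a direct summand U of Ind_P^G(k) (complement W a submodule),
   M is indecomposable, and its socle contains the trivial module
   (i.e. M has a nonzero G-fixed vector). *)
Definition is_scott_module (G P : {group gT}) n (rG : mx_representation F G n) :=
  [/\ exists B : 'M[F]_(n, #|rcosets P G|),
        [/\ row_free B,
            forall x, x \in G -> B *m perm_coset_mx G P x = rG x *m B &
            exists W : 'M[F]_#|rcosets P G|,
              [/\ mx_stable (perm_coset_mx G P) G W,
                  (B :&: W <= (0 : 'M[F]_#|rcosets P G|))%MS & (B + W :=: 1%:M)%MS]],
      mod_indecomposable rG G &
      rfix_mx rG G != 0].

End Scott.

Section Fusion.
Variable gT : finGroupType.
Implicit Types (G P Q : {group gT}).

Definition AutF G Q := conj_aut Q @* 'N_G(Q).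
Definition AutP P Q := conj_aut Q @* 'N_P(Q).

Definition fully_normalized G P Q :=
  forall g, g \in G -> Q :^ g \subset P -> (#|'N_P(Q :^ g)| <= #|'N_P(Q)|)%N.
Definition fully_centralized G P Q :=
  forall g, g \in G -> Q :^ g \subset P -> (#|'C_P(Q :^ g)| <= #|'C_P(Q)|)%N.

(* For phi = c_g : Q -> Q^g (x |-> x^g), N_phi = { y in N_P(Q) :
   phi c_y phi^-1 = c_{y^g} restricted to Q^g lies in Aut_P(Q^g) }. *)
Definition N_phi P Q (g : gT) :=
  [set y in 'N_P(Q) | conj_aut (Q :^ g)%G (y ^ g) \in AutP P (Q :^ g)%G].

(* Saturation of F_P(G) (Broto-Levi-Oliver axioms). *)
Definition saturated_fusion (p : nat) G P :=
  (forall Q, Q \subset P -> fully_normalized G P Q ->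
     fully_centralized G P Q /\ p.-Sylow(AutF G Q) (AutP P Q)) /\
  (forall Q (g : gT), Q \subset P -> g \in G -> Q :^ g \subset P ->
     fully_centralized G P (Q :^ g)%G ->
     exists2 h, h \in G &
       N_phi P Q g :^ h \subset P /\ (forall x, x \in Q -> x ^ h = x ^ g)).

End Fusion.

Arguments is_scott_module {F gT} G P {n} rG.
Arguments brauer_indecomposable {F gT G n} rG p.
Arguments mod_indecomposable {F gT n} r H.

(* Main.v *)
Require Import Defs.
From HB Require Import structures.
From mathcomp Require Import all_boot all_order all_algebra all_fingroup all_solvable all_field.
From mathcomp Require Import mxrepresentation.
Local Open Scope group_scope.

(** Write M = S(G,P) as a summand of the permutation module k[P\G] and let e be
    the restriction to M of the augmentation.  Row and column sums of the
    projection onto M agree, so e is compatible with the projection and is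
    nonzero on P-fixed vectors, whereas it kills all relative traces.

    - The Brauer quotient M(P) has a unique maximal N_G(P)-submodule, ker e: a
      P-fixed l with e(l) = 1 induces the endomorphism Pg |-> l g of M, which
      preserves e and is therefore invertible.  By saturation P C_G(P) has
      p'-index in N_G(P), and by a Clifford-type argument the unique maximal
      submodule persists on restriction to P C_G(P).
    - If M is indecomposable over C_G(T), T <= P, then splitting k[P\G] into
      the T-fixed cosets and the others shows that T acts trivially on M.
    - Hence for Q <= P either M(Q) = M with Q in some such T, or M(Q) = M(P) as
      C_G(P)-modules. *)

(** * Sums over right transversals and right cosets *)

Section TransversalSums.
Set Implicit Arguments. Unset Strict Implicit.
Import GRing.Theory.
Local Open Scope ring_scope.
Variable gT : finGroupType.
Implicit Types (S H Q : {group gT}) (X Y : {set gT}).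

(** The right-hand side does not mention [X], so every transversal gives the same sum. A relative
    trace, defined with one chosen transversal, can thus be computed with whichever is
    convenient. *)
Lemma sum_rcosets (V : nmodType) S H X (f : gT -> V) :
    X \subset H -> H \subset (S * X)%g -> {in X &, injective (rcoset S)} ->
    (forall s h, s \in S -> h \in H -> f (s * h)%g = f h) ->
  S \subset H -> \sum_(x in X) f x = \sum_(A in rcosets S H) f (repr A).
Proof.
move=> sXH sHSX injX fS sSH.
have -> : rcosets S H = rcoset S @: X.
  apply/setP=> A; apply/imsetP/imsetP=> [[h Hh ->] | [x Xx ->]]; last first.
    by exists x; rewrite // (subsetP sXH).
  have /mulsgP[s x Ss Xx ->] := subsetP sHSX h Hh.
  by exists x; rewrite // !rcosetE rcosetM (rcoset_id Ss).
rewrite big_imset //=; apply: eq_bigr => x Xx; rewrite rcosetE.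
by case: repr_rcosetP => s Ss; rewrite fS // (subsetP sXH).
Qed.

Lemma rcosets_transversalP S H (X := transversal (rcosets S H) H) :
  S \subset H ->
  [/\ X \subset H, H \subset (S * X)%g, {in X &, injective (rcoset S)}
    & #|X| = #|H : S|].
Proof.
move=> sSH; have trX := transversalP (rcosets_partition sSH).
have tI : trivIset (rcosets S H) by case/and3P: (rcosets_partition sSH).
have pbE x : x \in H -> pblock (rcosets S H) x = rcoset S x.
  move=> Hx; apply: def_pblock => //; first by apply: imset_f.
  by rewrite rcosetE rcoset_refl.
have sXH := transversal_sub trX; split=> //.
- apply/subsetP=> h Hh.
  have: rcoset S h \in rcosets S H by apply: imset_f.
  rewrite -(pblock_transversal trX) => /imsetP[x Xx].
  rewrite pbE ?(subsetP sXH) // => e.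
  have: h \in rcoset S x by rewrite -e rcosetE rcoset_refl.
  by rewrite rcosetE => /rcosetP[s Ss ->]; apply: mem_mulg.
- move=> x y Xx Xy e; apply: (pblock_inj trX) => //.
  by rewrite !pbE ?(subsetP sXH).
- exact: card_transversal trX.
Qed.

Lemma transversal_rcoset S H X x :
    X \subset H -> H \subset (S * X)%g -> {in X &, injective (rcoset S)} ->
  x \in H -> [/\ (X :* x)%g \subset H, H \subset (S * (X :* x))%g
                & {in (X :* x)%g &, injective (rcoset S)}].
Proof.
move=> sXH sHX injX Hx; split.
- by apply/subsetP=> _ /rcosetP[y Xy ->]; rewrite groupM // (subsetP sXH).
- by rewrite mulgA sub_rcoset rcoset_id ?groupV.
- move=> _ _ /rcosetP[y Xy ->] /rcosetP[z Xz ->]; rewrite !rcosetE !rcosetM.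
  by move/rcoset_inj=> e; rewrite (injX y z) // !rcosetE.
Qed.

(** The cosets of [S] inside [S' :* h] are the translates by [h] of the cosets of [S] in [S'], so
    each value of [f] is repeated [#|S' : S|] times. In characteristic p this kills traces of
    vectors fixed by a p-group [S'] properly containing [S]. *)
Lemma sum_rcosets_mulr (V : nmodType) S S' H (f : gT -> V) :
    S \subset S' -> S' \subset H ->
    (forall s h, s \in S' -> h \in H -> f (s * h)%g = f h) ->
  \sum_(A in rcosets S H) f (repr A)
    = (\sum_(A in rcosets S' H) f (repr A)) *+ #|S' : S|.
Proof.
move=> sSS' sS'H fS'; have sSH := subset_trans sSS' sS'H.
rewrite (partition_big (fun A => (S' * A)%g) (mem (rcosets S' H))) /=; last first.
  move=> _ /rcosetsP[h Hh ->]; rewrite mulgA mulGSid //.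
  by apply/rcosetsP; exists h.
rewrite -sumrMnl; apply: eq_bigr => _ /rcosetsP[h Hh ->].
have fR y (K : {group gT}) : K \subset S' -> y \in H -> f (repr (K :* y)%g) = f y.
  move=> sKS' Hy; have: repr (K :* y)%g \in (K :* y)%g.
    by apply: (@mem_repr _ _ y); apply: rcoset_refl.
  by case/rcosetP=> s Ks ->; rewrite fS' // (subsetP sKS').
rewrite fR // -[RHS]sumr_const.
have injh : injective (fun A : {set gT} => A :* h)%g by apply: rcoset_inj.
transitivity (\sum_(A in [set A :* h | A in rcosets S S']%g) f h).
  apply: eq_big => [A | A /andP[/rcosetsP[y Hy ->]]]; last first.
    rewrite mulgA mulGSid // => /eqP e; rewrite fR //.
    have: y \in (S' :* h)%g by rewrite -e rcoset_refl.
    by case/rcosetP=> s S's ->; rewrite fS'.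
  apply/andP/imsetP=> [[/rcosetsP[y Hy ->]] | [_ /rcosetsP[s S's ->] ->]].
    rewrite mulgA mulGSid // => /eqP e.
    have: y \in (S' :* h)%g by rewrite -e rcoset_refl.
    case/rcosetP=> s S's ->; exists (S :* s)%g; last by rewrite rcosetM.
    by apply/rcosetsP; exists s.
  rewrite -rcosetM mulgA mulGSid // (rcosetM S') (rcoset_id S's); split=> //.
  apply/rcosetsP; exists (s * h)%g => //.
  by rewrite groupM // (subsetP sS'H).
by rewrite big_imset //= => A B _ _; apply: injh.
Qed.
End TransversalSums.

(** * Relative traces and the subspace divided out in the Brauer quotient *)

Section RelativeTraces.
Set Implicit Arguments. Unset Strict Implicit.
Import GRing.Theory.
Local Open Scope ring_scope.
Variables (F : fieldType) (gT : finGroupType) (G : {group gT}) (n : nat).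
Variable rG : mx_representation F G n.
Implicit Types (S Q T : {group gT}) (X : {set gT}).

Lemma fix_mulmx_repr m (u : 'M_(m, n)) S Q :
    Q \subset G -> S \subset Q -> (u <= rfix_mx rG S)%MS ->
  forall s h, s \in S -> h \in Q -> u *m rG (s * h)%g = u *m rG h.
Proof.
move=> sQG sSQ /rfix_mxP fixu s h Ss Qh.
have [Qs Gh] := (subsetP sSQ s Ss, subsetP sQG h Qh).
by rewrite repr_mxM ?(subsetP sQG) // mulmxA fixu.
Qed.

Lemma mul_rel_trace_mx m (u : 'M_(m, n)) S Q :
    Q \subset G -> S \subset Q -> (u <= rfix_mx rG S)%MS ->
  u *m rel_trace_mx rG S Q = \sum_(A in rcosets S Q) u *m rG (repr A).
Proof.
move=> sQG sSQ fixu; have [sXQ sQX injX _] := rcosets_transversalP sSQ.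
rewrite mulmx_sumr; apply: (sum_rcosets sXQ sQX injX) => //.
exact: fix_mulmx_repr.
Qed.

Lemma mul_rel_trace_transversal m (u : 'M_(m, n)) S Q X :
    Q \subset G -> S \subset Q -> (u <= rfix_mx rG S)%MS ->
    X \subset Q -> Q \subset (S * X)%g -> {in X &, injective (rcoset S)} ->
  u *m rel_trace_mx rG S Q = \sum_(x in X) u *m rG x.
Proof.
move=> sQG sSQ fixu sXQ sQX injX; rewrite mul_rel_trace_mx //.
by apply/esym/(sum_rcosets sXQ sQX injX) => //; apply: fix_mulmx_repr.
Qed.

(** Right translation by an element of [Q] carries one transversal to another, and the trace does
    not see the difference. *)
Lemma rel_trace_fix S Q :
    Q \subset G -> S \subset Q ->
  (rfix_mx rG S *m rel_trace_mx rG S Q <= rfix_mx rG Q)%MS.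
Proof.
move=> sQG sSQ; apply/rfix_mxP=> q Qq; have Gq := subsetP sQG q Qq.
have [sXQ sQX injX _] := rcosets_transversalP sSQ.
have [sYQ sQY injY] := transversal_rcoset sXQ sQX injX Qq.
rewrite [RHS](mul_rel_trace_transversal sQG sSQ (submx_refl _) sYQ sQY injY).
rewrite -rcosetE big_imset /=; last by move=> x y _ _; apply: mulIg.
rewrite mulmx_sumr mulmx_suml; apply: eq_bigr => x Xx.
by rewrite -mulmxA -repr_mxM // (subsetP sQG) // (subsetP sXQ).
Qed.

Lemma rel_trace_sub_brauer m (u : 'M_(m, n)) S Q :
    S \proper Q -> (u <= rfix_mx rG S)%MS ->
  (u *m rel_trace_mx rG S Q <= brauer_trace_space rG Q)%MS.
Proof.
by move=> prSQ fixu; rewrite (sumsmx_sup S) // submxMr.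
Qed.

Lemma brauer_trace_subP m (L : 'M_(m, n)) Q :
  (forall S, S \proper Q ->
     (rfix_mx rG S *m rel_trace_mx rG S Q <= L)%MS) ->
  (brauer_trace_space rG Q <= L)%MS.
Proof. by move=> sL; apply/sumsmx_subP. Qed.

Lemma brauer_trace_fix Q :
  Q \subset G -> (brauer_trace_space rG Q <= rfix_mx rG Q)%MS.
Proof.
by move=> sQG; apply: brauer_trace_subP => S /proper_sub; apply: rel_trace_fix.
Qed.

(* The summands over a nontrivial Q-orbit add up to a relative trace from the
   stabiliser of a point of that orbit. *)
Lemma sum_equivariant_sub (I : finType) (to : {action gT &-> I})
    (D : {set I}) Q (f : I -> 'rV[F]_n) (L : 'M_n) :
    Q \subset G -> [acts Q, on D | to] ->
    (forall x q, x \in D -> q \in Q -> f (to x q) = f x *m rG q) ->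
    (forall x, x \in D -> (forall q, q \in Q -> to x q = x) -> (f x <= L)%MS) ->
    (brauer_trace_space rG Q <= L)%MS ->
  ((\sum_(x in D) f x)%R <= L)%MS.
Proof.
move=> sQG actsQ fQ fixL sTL.
rewrite (set_partition_big _ (orbit_partition actsQ)).
apply: summx_sub => _ /imsetP[x Dx ->].
have [Qx | ntx] := boolP (Q \subset 'C[x | to]%g).
  have cx q : q \in Q -> to x q = x by move=> Qq; apply/astab1P/(subsetP Qx).
  have -> : orbit to Q x = [set x].
    apply/setP=> y; apply/imsetP/set1P=> [[q Qq ->] | ->]; first exact: cx.
    by exists 1%g; rewrite ?group1 // act1.
  by rewrite big_set1; apply: fixL.
pose S := 'C_Q[x | to]%G.
have sSQ : S \subset Q by apply: subsetIl.
have prSQ : S \proper Q by rewrite properE sSQ subsetI subxx.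
have fixS : (f x <= rfix_mx rG S)%MS.
  apply/rfix_mxP=> s /setIP[Qs /astab1P cs].
  by rewrite -fQ // cs.
have [sXQ sQX injX _] := rcosets_transversalP sSQ.
set X := transversal _ _ in sXQ sQX injX.
have actS y z : y \in Q -> z \in Q -> to x y = to x z -> rcoset S y = rcoset S z.
  move=> Qy Qz e; rewrite !rcosetE; apply/rcoset_eqP.
  rewrite mem_rcoset !inE groupM ?groupV //=.
  by rewrite sub1set inE actM e actK.
have -> : orbit to Q x = to x @: X.
  apply/setP=> y; apply/imsetP/imsetP=> [[q Qq ->] | [z Xz ->]]; last first.
    by exists z => //; apply: (subsetP sXQ).
  have /mulsgP[s z /setIP[_ /astab1P cs] Xz ->] := subsetP sQX q Qq.
  by exists z => //; rewrite actM cs.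
rewrite big_imset /=; last first.
  by move=> y z Xy Xz /actS e; apply: injX => //; apply: e; apply: (subsetP sXQ).
rewrite (eq_bigr (fun y => f x *m rG y)); last first.
  by move=> y Xy; rewrite fQ // (subsetP sXQ).
rewrite -(mul_rel_trace_transversal sQG sSQ fixS sXQ sQX injX).
exact: submx_trans (rel_trace_sub_brauer prSQ fixS) sTL.
Qed.

(** * Relative traces of p-groups in characteristic p *)

Section Characteristic.
Variable p : nat.
Hypothesis pF : p \in [pchar F].

Lemma proper_index_pchar S Q :
  p.-group Q -> S \proper Q -> (#|Q : S|%:R = 0 :> F).
Proof.
move=> pQ /properP[sSQ [x Qx nSx]]; apply/eqP; rewrite -(dvdn_pcharf pF).
have p_pr := pcharf_prime pF.
have: p.-nat #|Q : S| by apply: pnat_dvd (dvdn_indexg Q S) pQ.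
case/p_natP=> [[|k] e].
  by case/negP: nSx; apply: (subsetP _ x Qx); rewrite -indexg_eq1 e.
by rewrite e expnS dvdn_mulr.
Qed.

(** On a trace from [S] the functional takes [#|Q : S|] times its value on the original vector, and
    p divides this index. *)
Lemma brauer_trace_invariant (e : 'cV[F]_n) Q :
    p.-group Q -> (forall x, x \in Q -> rG x *m e = e) ->
  brauer_trace_space rG Q *m e = 0.
Proof.
move=> pQ eQ; apply/sub_kermxP/brauer_trace_subP => S prSQ.
have sSQ := proper_sub prSQ; apply/sub_kermxP.
have [sXQ _ _ cX] := rcosets_transversalP sSQ.
rewrite -mulmxA mulmx_suml (eq_bigr (fun=> e)); last first.
  by move=> x Xx; rewrite eQ // (subsetP sXQ).
by rewrite sumr_const cX -scaler_nat (proper_index_pchar pQ prSQ) scale0r mulmx0.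
Qed.

(** When [Q] acts trivially, the trace from a proper subgroup is multiplication by an index
    divisible by p. Hence M(Q) is all of M. *)
Lemma brauer_trace_rker Q :
  p.-group Q -> Q \subset rker rG -> brauer_trace_space rG Q = 0.
Proof.
move=> pQ kQ; apply/eqP; rewrite -submx0; apply: brauer_trace_subP => S prSQ.
have sSQ := proper_sub prSQ.
have [sXQ _ _ cX] := rcosets_transversalP sSQ.
rewrite /rel_trace_mx (eq_bigr (fun=> 1%:M)); last first.
  by move=> x Xx; have /rkerP[] := subsetP kQ x (subsetP sXQ x Xx).
by rewrite sumr_const cX -scaler_nat (proper_index_pchar pQ prSQ) scale0r mulmx0 sub0mx.
Qed.

Lemma rfix_rker m (u : 'M_(m, n)) Q : Q \subset rker rG -> (u <= rfix_mx rG Q)%MS.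
Proof.
by move=> kQ; apply/rfix_mxP=> x /(subsetP kQ)/rkerP[_ ->]; rewrite mulmx1.
Qed.

Lemma maximal_mulg (P : {group gT}) T Q :
    p.-group P -> maximal T P -> Q \subset P -> ~~ (Q \subset T) ->
  P :=: (T * Q)%g.
Proof.
move=> pP maxT sQP nQT; have sTP := proper_sub (maxgroupp maxT).
have nTP : P \subset 'N(T) by apply: normal_norm; apply: p_maximal_normal pP maxT.
apply/eqP; rewrite eqEsubset mul_subG // andbT.
case/maxgroupP: maxT => _ maxT.
have [prJ | ] := boolP ((T <*> Q)%G \proper P).
  by case/negP: nQT; rewrite -(maxT _ prJ) ?joing_subl ?joing_subr.
rewrite properE join_subG sTP sQP /= negbK norm_joinEr //.
exact: subset_trans sQP nTP.
Qed.

(* Writing S' = ST for S < P, the trace from S is |S' : S| times the one from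
   S', so only S = T contributes, and T \ P = (Q :&: T) \ Q. *)
Lemma brauer_trace_maximal (P : {group gT}) T Q :
    P \subset G -> p.-group P -> maximal T P -> T \subset rker rG ->
    Q \subset P -> ~~ (Q \subset T) ->
  (brauer_trace_space rG P <= brauer_trace_space rG Q)%MS.
Proof.
move=> sPG pP maxT kT sQP nQT; apply: brauer_trace_subP => S prSP.
have sSP := proper_sub prSP; have sTP := maxgroupp maxT; have sTP' := proper_sub sTP.
have nTP : P \subset 'N(T) by apply: normal_norm; apply: p_maximal_normal pP maxT.
pose S' := (S <*> T)%G; set u := rfix_mx rG S.
have sS'P : S' \subset P by rewrite join_subG sSP.
have sSS' : S \subset S' by apply: joing_subl.
have fixS' : (u <= rfix_mx rG S')%MS.
  apply/rfix_mxP=> x; rewrite /= norm_joinEl ?(subset_trans sSP) //.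
  case/mulsgP=> s t Ss Tt ->; have [Gt t1] := rkerP (subsetP kT t Tt).
  by rewrite repr_mxM ?(subsetP sPG _ (subsetP sSP _ Ss)) // t1 mulmx1 rfix_mx_id.
rewrite mul_rel_trace_mx //.
rewrite (sum_rcosets_mulr sSS' sS'P (fix_mulmx_repr sPG sS'P fixS')).
have [eSS' | nSS'] := eqVneq (S : {set gT}) S'; last first.
  rewrite -scaler_nat (proper_index_pchar (pgroupS sS'P pP)) ?scale0r ?sub0mx //.
  by rewrite properEneq nSS'.
have sTS : T \subset S by rewrite eSS' joing_subr.
have eST : S = T :> {set gT}.
  by have /maxgroupP[_ /(_ S prSP sTS)] := maxT.
rewrite -eSS' indexgg mulr1n -mul_rel_trace_mx // eST.
pose K := (Q :&: T)%G.
have prK : K \proper Q by rewrite properE subsetIl subsetI subxx.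
have sKQ := proper_sub prK.
have [sXQ sQX injX _] := rcosets_transversalP sKQ.
have ePQ := maximal_mulg pP maxT sQP nQT.
rewrite (mul_rel_trace_transversal sPG sTP' _ _ _ _ (X := transversal (rcosets K Q) Q)).
- rewrite -mulmx_sumr -/(rel_trace_mx rG K Q) rel_trace_sub_brauer // rfix_rker //.
  by apply: subset_trans kT; apply: subsetIr.
- exact: rfix_rker.
- exact: subset_trans sXQ sQP.
- rewrite ePQ (subset_trans (mulgS T sQX)) // mulgA mulSg //.
  by rewrite mulG_subG subxx subsetIr.
- move=> x y Xx Xy exy; apply: injX => //; have Qx := subsetP sXQ x Xx.
  have Qy := subsetP sXQ y Xy; move: exy; rewrite !rcosetE.
  move/rcoset_eqP; rewrite mem_rcoset => Txy.
  by apply/rcoset_eqP; rewrite mem_rcoset !inE Txy groupM ?groupV.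
Qed.

End Characteristic.
End RelativeTraces.

(** * Indecomposability, Fitting's lemma and unique maximal submodules *)

Section Indecomposability.
Set Implicit Arguments. Unset Strict Implicit.
Import GRing.Theory.
Local Open Scope ring_scope.
Variables (F : fieldType) (gT : finGroupType).

Lemma sub_subquot_indecomposable n (r : gT -> 'M[F]_n) (H K : {set gT}) V T :
  H \subset K -> subquot_indecomposable r H V T -> subquot_indecomposable r K V T.
Proof.
move=> sHK [nzV indV]; split=> // A B sA sB; apply: indV => x Hx.
  by apply: sA; apply: (subsetP sHK).
by apply: sB; apply: (subsetP sHK).
Qed.

Lemma eqmx_subquot_indecomposable n (r : gT -> 'M[F]_n) (H : {set gT}) V T V' T' :
    (V :=: V')%MS -> (T :=: T')%MS ->
  subquot_indecomposable r H V T -> subquot_indecomposable r H V' T'.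
Proof.
move=> eV eT [nzV indV]; split=> [|A B]; first by rewrite -eV -eT.
by rewrite -!eV -!eT; apply: indV.
Qed.

(** Squaring cannot lower the rank forever. For the power reached, image and kernel meet
    trivially. *)
Lemma rank_exprM_stable n (a : 'M[F]_n) :
  exists2 m, (0 < m)%N & \rank (a ^+ m *m a ^+ m) = \rank (a ^+ m).
Proof.
suff H k m : (0 < m)%N -> (\rank (a ^+ m) <= k)%N ->
    exists2 m, (0 < m)%N & \rank (a ^+ m *m a ^+ m) = \rank (a ^+ m).
  by apply: (H (\rank a) 1%N); rewrite ?expr1.
elim: k m => [|k IHk] m m_gt0 le_mk.
  exists m => //; apply/eqP; rewrite eqn_leq mxrankM_maxl /=.
  exact: leq_trans le_mk _.
have := mxrankM_maxl (a ^+ m) (a ^+ m); rewrite leq_eqVlt => /predU1P[e|lt].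
  by exists m.
apply: (IHk (m + m)%N); first by rewrite addn_gt0 m_gt0.
by rewrite exprD -ltnS; apply: leq_trans lt le_mk.
Qed.

(** Image and kernel of a power [b] of stable rank are complementary submodules, so one of them is
    zero. It is not the image, as [a] is not nilpotent. *)
Lemma fitting n (r : gT -> 'M[F]_n) (H : {set gT}) (a : 'M[F]_n) :
    mod_indecomposable r H -> (forall x, x \in H -> a *m r x = r x *m a) ->
    (forall m, a ^+ m != 0) ->
  a \in unitmx.
Proof.
move=> [_ indM] ca nzX; have [m m_gt0 /mxrank_injP/eqP tiK] := rank_exprM_stable a.
set b := a ^+ m in tiK.
have cb x : x \in H -> b *m r x = r x *m b.
  move=> Hx; rewrite /b; elim: m {m_gt0 b tiK} => [|m IHm].
    by rewrite expr0 mulmx1 mul1mx.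
  by rewrite exprS -!mulmxE -mulmxA IHm !mulmxA ca.
have sb : mx_stable r H b by move=> x Hx; rewrite cb // submxMl.
have sK : mx_stable r H (kermx b).
  by move=> x Hx; apply/sub_kermxP; rewrite -mulmxA -cb // mulmxA mulmx_ker mul0mx.
have full : (1%:M <= b + kermx b)%MS.
  rewrite sub1mx
    -col_leq_rank mxrank_disjoint_sum //.
  by rewrite mxrank_ker subnKC ?rank_leq_row.
case: (indM b (kermx b) sb sK _ _ _ _ _ full); rewrite ?sub0mx ?submx1 ?tiK //.
  by rewrite submx0 (negPf (nzX m)).
rewrite submx0 kermx_eq0 row_free_unit /b -(prednK m_gt0) exprS -mulmxE.
by rewrite unitmx_mul => /andP[].
Qed.

Lemma functional_nz_vector n (L : 'M[F]_n) (e : 'cV[F]_n) :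
  L *m e != 0 -> exists2 l : 'rV_n, (l <= L)%MS & l *m e = 1%:M.
Proof.
move=> nzLe; have [i nzi] : exists i, (L *m e) i 0 != 0.
  apply/existsP; apply: contraNT nzLe; rewrite negb_exists => /forallP z.
  by apply/eqP/matrixP=> i j; rewrite ord1 [RHS]mxE; apply/eqP; have:= z i; rewrite negbK.
exists (((L *m e) i 0)^-1 *: row i L); first by rewrite scalemx_sub ?row_sub.
rewrite -scalemxAl -row_mul; apply/matrixP=> j k.
by rewrite !ord1 !mxE eqxx mulr1n -[RHS](mulVf nzi) !mxE.
Qed.

(** With [l] in [L] and [l *m e = 1], subtracting [u *m e *m l] moves [u] into the kernel of [e],
    where the first hypothesis applies. *)
Lemma sub_functional n m (V L : 'M[F]_n) (u : 'M_(m, n)) (e : 'cV[F]_n) :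
    (V :&: kermx e <= L)%MS -> L *m e != 0 -> (L <= V)%MS -> (u <= V)%MS ->
  (u <= L)%MS.
Proof.
move=> sVL /functional_nz_vector[l sl le] sLV sUV.
have slV : (u *m e *m l <= V)%MS.
  by rewrite (submx_trans (submxMl _ _)) // (submx_trans sl).
rewrite -[u](subrK (u *m e *m l)); apply: addmx_sub; last first.
  exact: submx_trans (submxMl _ _) sl.
apply: submx_trans sVL; rewrite sub_capmx addmx_sub ?eqmx_opp //=.
by apply/sub_kermxP; rewrite mulmxBl -[_ *m l *m e]mulmxA le mulmx1 subrr.
Qed.

(* For H-stable T <= V and an H-invariant functional e vanishing on T, this says
   that V / T has a unique maximal submodule, namely the kernel of e. *)
Definition head_local n (r : gT -> 'M[F]_n) (H : {set gT}) (e : 'cV[F]_n)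
    (V T : 'M[F]_n) :=
  forall L : 'M[F]_n, mx_stable r H L -> (T <= L)%MS -> (L <= V)%MS ->
    L *m e != 0 -> (V <= L)%MS.

Lemma sub_head_local n (r : gT -> 'M[F]_n) (H K : {set gT}) e V T T' :
    H \subset K -> (T <= T')%MS ->
  head_local r H e V T -> head_local r K e V T'.
Proof.
move=> sHK sTT' hlV L sL sTL; apply: hlV; last exact: submx_trans sTL.
by move=> x Hx; apply: sL; apply: (subsetP sHK).
Qed.

(** In a decomposition [e] is nonzero on one summand. That summand is all of [V], so the other lies
    in the intersection, hence in [T]. *)
Lemma head_local_indecomposable n (r : gT -> 'M[F]_n) (H : {set gT}) e V T :
    T *m e = 0 -> V *m e != 0 -> head_local r H e V T ->
  subquot_indecomposable r H V T.
Proof.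
move=> Te0 nzVe hlV; split=> [|A B sA sB sTA sAV sTB sBV tiAB sVAB].
  apply: contra nzVe => /submxP[u ->].
  by rewrite -mulmxA Te0 mulmx0.
have [Ae0 | nzAe] := eqVneq (A *m e) 0; last first.
  right; apply: submx_trans tiAB; rewrite sub_capmx submx_refl andbT.
  exact: submx_trans sBV (hlV _ sA sTA sAV nzAe).
have [Be0 | nzBe] := eqVneq (B *m e) 0; last first.
  left; apply: submx_trans tiAB; rewrite sub_capmx submx_refl /=.
  exact: submx_trans sAV (hlV _ sB sTB sBV nzBe).
case/eqP: nzVe; case/sub_addsmxP: sVAB => u ->.
by rewrite mulmxDl -!mulmxA Ae0 Be0 !mulmx0 addr0.
Qed.

(** * Conjugates of subquotients, and descent of a unique maximal submodule to a normal subgroup *)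

Section Representation.
Variables (G : {group gT}) (n : nat) (rG : mx_representation F G n).

Lemma subquot_indecomposable_conj (H : {set gT}) V T g :
    g \in G -> H \subset G -> subquot_indecomposable rG H V T ->
  subquot_indecomposable rG (H :^ g) (V *m rG g) (T *m rG g).
Proof.
move=> Gg sHG [nVT indV].
have mvR m1 m2 (A : 'M_(m1, n)) (B : 'M_(m2, n)) :
    (A <= B *m rG g)%MS = (A *m rG g^-1%g <= B)%MS.
  by apply/idP/idP=> /(submxMr _) s; [have:= s _ (rG g^-1%g) | have:= s _ (rG g)];
    rewrite ?repr_mxK ?repr_mxKV.
have mvL m1 m2 (A : 'M_(m1, n)) (B : 'M_(m2, n)) :
    (A *m rG g <= B)%MS = (A <= B *m rG g^-1%g)%MS.
  by apply/idP/idP=> /(submxMr _) s; [have:= s _ (rG g^-1%g) | have:= s _ (rG g)];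
    rewrite ?repr_mxK ?repr_mxKV.
have stJ (A : 'M_n) : mx_stable rG (H :^ g) A -> mx_stable rG H (A *m rG g^-1%g).
  move=> sA x Hx; have Gx := subsetP sHG x Hx.
  rewrite -mvL -!mulmxA -!repr_mxM ?groupM ?groupV //.
  by rewrite -conjgE; apply: sA; rewrite memJ_conjg.
split=> [|A B sA sB]; first by rewrite mvR repr_mxK.
rewrite !mvL !mvR => sTA sAV sTB sBV tiAB sVAB.
apply: (indV _ _ (stJ A sA) (stJ B sB)) => //.
  by apply: submx_trans tiAB; rewrite -mvL sub_capmx !mvL capmxSl capmxSr /=.
by apply: submx_trans sVAB _; rewrite addsmxMr.
Qed.

Variables (N C : {group gT}) (V T : 'M[F]_n) (e : 'cV[F]_n).
Hypotheses (sNG : N \subset G) (nCN : C <| N) (p'NC : (#|N : C|%:R != 0 :> F)).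
Hypotheses (sV : mx_stable rG N V) (sT : mx_stable rG N T) (sTV : (T <= V)%MS).
Hypotheses (eN : forall x, x \in N -> rG x *m e = e) (Te0 : T *m e = 0).
Hypothesis hlV : head_local rG N e V T.

Let sCN : C \subset N := normal_sub nCN.
Let GN x (Nx : x \in N) : x \in G := subsetP sNG x Nx.
Let NC x (Cx : x \in C) : x \in N := subsetP sCN x Cx.
(** [V / J] is the largest quotient of [V / T] on which [C] acts trivially. *)
Let J : 'M[F]_n := (T + \sum_(c in C) V *m (rG c - 1%:M))%MS.

Let sTJ : (T <= J)%MS. Proof. exact: addsmxSl. Qed.

Let sVJ c : c \in C -> (V *m (rG c - 1%:M) <= J)%MS.
Proof. by move=> Cc; rewrite (submx_trans _ (addsmxSr _ _)) // (sumsmx_sup c). Qed.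

Let sJP m (L : 'M_(m, n)) :
  (T <= L)%MS -> (forall c, c \in C -> (V *m (rG c - 1%:M) <= L)%MS) -> (J <= L)%MS.
Proof. by move=> sTL sVL; rewrite addsmx_sub sTL; apply/sumsmx_subP. Qed.

Let sJN : mx_stable rG N J.
Proof.
move=> x Nx; rewrite addsmxMr addsmx_sub (submx_trans (sT Nx)) //= sumsmxMr.
apply/sumsmx_subP=> c Cc.
have Nc := NC Cc.
have Ccx : (c ^ x)%g \in C by rewrite memJ_norm // (subsetP (normal_norm nCN)).
apply: submx_trans (sVJ Ccx).
have -> : V *m (rG c - 1%:M) *m rG x = V *m rG x *m (rG (c ^ x)%g - 1%:M).
  rewrite !mulmxBr !mulmx1 mulmxBl -!mulmxA -!repr_mxM ?GN ?groupJ //.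
  by rewrite -conjgC.
by rewrite submxMr // sV.
Qed.

Let sJV : (J <= V)%MS.
Proof.
apply: sJP => // c Cc; rewrite mulmxBr mulmx1 addmx_sub ?eqmx_opp //.
by rewrite sV // NC.
Qed.

Let Je0 : J *m e = 0.
Proof.
apply/sub_kermxP/sJP=> [|c Cc]; apply/sub_kermxP => //.
by rewrite -mulmxA mulmxBl mul1mx eN ?NC // subrr mulmx0.
Qed.

(* Averaging over N / C makes a vector N-invariant modulo J = T + [V, C]. *)
Let ker_sub_J : V *m e != 0 -> (V :&: kermx e <= J)%MS.
Proof.
case/functional_nz_vector=> v sv ve.
have [sXN sNX injX cX] := rcosets_transversalP sCN.
set X := transversal _ _ in sXN sNX injX cX.
pose w := \sum_(x in X) v *m rG x.
have we : w *m e = #|N : C|%:R%:M.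
  rewrite mulmx_suml (eq_bigr (fun=> 1%:M)) => [|x Xx].
    by rewrite sumr_const cX -scaler_nat scale_scalar_mx mulr1.
  by rewrite -mulmxA eN ?ve // (subsetP sXN).
have wJ x : x \in N -> (w *m rG x - w <= J)%MS.
  move=> Nx; rewrite submxE mulmxBl subr_eq0; apply/eqP.
  (* Modulo [J] the vector [v *m rG y] depends only on the coset [C :* y], so [X] and its translate
     [X :* x] give the same sum. *)
  pose f y := v *m rG y *m cokermx J.
  have fC s h : s \in C -> h \in N -> f (s * h)%g = f h.
    move=> Cs Nh; have Ns := NC Cs; apply/eqP; rewrite -subr_eq0 -mulmxBl -submxE.
    rewrite repr_mxM ?GN // mulmxA -mulmxBl -[v in _ - v]mulmx1 -mulmxBr.
    apply: submx_trans (sJN Nh); rewrite submxMr //.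
    by apply: submx_trans (sVJ Cs); rewrite submxMr.
  have -> : w *m rG x *m cokermx J = \sum_(y in X) f (y * x)%g.
    rewrite !mulmx_suml; apply: eq_bigr => y Xy; have Ny := subsetP sXN y Xy.
    by rewrite /f repr_mxM ?GN // [v *m (_ *m _)]mulmxA.
  have -> : w *m cokermx J = \sum_(y in X) f y by rewrite mulmx_suml.
  rewrite (sum_rcosets sXN sNX injX fC sCN) -(big_imset f); last first.
    by move=> y z _ _; apply: mulIg.
  have -> : [set (y * x)%g | y in X] = (X :* x)%g by rewrite -rcosetE.
  have [sYN sNY injY] := transversal_rcoset sXN sNX injX Nx.
  exact: sum_rcosets sYN sNY injY fC sCN.
(* [E] is [N]-stable and [e] takes the nonzero value [#|N : C|] on [w], so [E] is all of [V]. A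
   vector of [V] killed by [e] then has no [w]-component. *)
pose E := (J + w)%MS.
have sVE : (V <= E)%MS.
  apply: hlV.
  - move=> x Nx; rewrite addsmxMr addsmx_sub (submx_trans (sJN Nx)) ?addsmxSl //=.
    rewrite -[w *m _](subrK w) addmx_sub ?addsmxSr //.
    by rewrite (submx_trans (wJ x Nx)) ?addsmxSl.
  - exact: submx_trans sTJ (addsmxSl _ _).
  - rewrite addsmx_sub sJV /=; apply: summx_sub => x Xx.
    have Nx := subsetP sXN x Xx; apply: submx_trans (sV Nx); exact: submxMr.
  apply: contra p'NC => /eqP Ee0; have: w *m e = 0.
    by apply/sub_kermxP; apply: submx_trans (addsmxSr J w) _; apply/sub_kermxP.
  by rewrite we => /matrixP/(_ 0 0); rewrite !mxE eqxx mulr1n => ->.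
apply/rV_subP=> u; rewrite sub_capmx => /andP[/submx_trans/(_ sVE)].
case/sub_addsmxP=> -[a b] /= -> /sub_kermxP.
rewrite mulmxDl -!mulmxA Je0 mulmx0 add0r we mul_mx_scalar => /eqP.
rewrite scalemx_eq0 (negPf p'NC) /= => /eqP ->.
by rewrite mul0mx addr0 submxMl.
Qed.

(* Double induction: the second test module I shrinks while L grows. *)
Lemma head_local_normal : head_local rG C e V T.
Proof.
suff H k : forall I L : 'M[F]_n, mx_stable rG C I -> (T <= I)%MS -> (I <= V)%MS ->
    I *m e != 0 -> mx_stable rG C L -> (T <= L)%MS -> (L <= V)%MS ->
    L *m e != 0 -> (\rank I + (n - \rank L) < k)%N -> (V <= L)%MS.
  by move=> L sL sTL sLV nzLe; apply: (H _ L L).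
elim: k => // k IHk I L sI sTI sIV nzIe sL sTL sLV nzLe ltk.
apply: contraNT (nzLe) => nVL.
have cap_stable (A B : 'M[F]_n) : mx_stable rG C A -> mx_stable rG C B ->
    mx_stable rG C (A :&: B)%MS.
  move=> sA sB x Cx; rewrite sub_capmx (submx_trans _ (sA x Cx)) ?submxMr ?capmxSl //.
  by rewrite (submx_trans _ (sB x Cx)) ?submxMr ?capmxSr.
have add_stable (A B : 'M[F]_n) : mx_stable rG C A -> mx_stable rG C B ->
    mx_stable rG C (A + B)%MS.
  move=> sA sB x Cx; rewrite addsmxMr addsmx_sub.
  by rewrite (submx_trans (sA x Cx)) ?(submx_trans (sB x Cx)) ?addsmxSl ?addsmxSr.
have sker : mx_stable rG C (kermx e).
  by move=> x Cx; apply/sub_kermxP; rewrite -mulmxA eN ?NC // mulmx_ker.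
(* Otherwise [L] contains the [N]-module [K] generated by [I], and [K] is all of [V] by the
   hypothesis over [N]. *)
have [g Ng nIgL] : exists2 g, g \in N & ~~ (I *m rG g <= L)%MS.
  apply/exists_inP; apply: contraR nVL; rewrite negb_exists => /forallP sIL.
  pose K : 'M[F]_n := (\sum_(x in N) I *m rG x)%MS.
  have sIK : (I <= K)%MS by rewrite (sumsmx_sup 1%g) ?group1 // repr_mx1 mulmx1.
  apply: submx_trans (_ : (K <= L)%MS); last first.
    by apply/sumsmx_subP=> x Nx; have:= sIL x; rewrite Nx negbK.
  apply: hlV.
  - move=> x Nx; rewrite sumsmxMr; apply/sumsmx_subP=> y Ny.
    by rewrite -mulmxA -repr_mxM ?GN // (sumsmx_sup (y * x)%g) ?groupM.
  - exact: submx_trans sTI sIK.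
  - apply/sumsmx_subP=> x Nx; apply: submx_trans (sV Nx); exact: submxMr.
  - apply: contra nzIe => /eqP Ke0; apply/eqP/sub_kermxP.
    by apply: submx_trans sIK _; apply/sub_kermxP.
(* The translate is again a [C]-module, of the same rank and with the same values of [e], so it can
   replace [I] in the induction. *)
pose I' := I *m rG g; have Gg := GN Ng.
have sI' : mx_stable rG C I'.
  move=> x Cx; have Nx := NC Cx; have Cx' : (x ^ g^-1)%g \in C.
    by rewrite memJ_norm // groupV (subsetP (normal_norm nCN)).
  have -> : I' *m rG x = I *m rG (x ^ g^-1)%g *m rG g.
    by rewrite -!mulmxA -!repr_mxM ?GN ?groupJ ?groupV // conjgE invgK -!mulgA mulVg mulg1.
  exact: submxMr (sI _ Cx').
have sTI' : (T <= I')%MS.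
  have := sT (groupVr Ng) => /submx_trans/(_ sTI)/(submxMr (rG g)).
  by rewrite repr_mxKV.
have sI'V : (I' <= V)%MS by apply: submx_trans (sV Ng); exact: submxMr.
have I'e : I' *m e = I *m e by rewrite -mulmxA eN.
have rI' : \rank I' = \rank I by rewrite mxrankMfree // row_free_unit repr_mx_unit.
have {nIgL} nI'L : ~~ (I' <= L)%MS by [].
clearbody I'.
(* Otherwise the induction applies to the pair of [I' :&: L], of smaller rank than [I], and [L]. *)
have capE0 : (I' :&: L)%MS *m e = 0.
  apply/eqP; apply: contraNT nVL => nzIL.
  apply: (IHk (I' :&: L)%MS L) => //; first exact: cap_stable.
  - by rewrite sub_capmx sTI'.
  - exact: submx_trans (capmxSl _ _) sI'V.
  apply: leq_trans _ (ltk : (_ <= k)%N); rewrite ltn_add2r -rI'.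
  rewrite ltn_neqAle mxrankS ?capmxSl // andbT.
  apply: contra nI'L => /eqP rk.
  have := mxrank_leqif_sup (capmxSl I' L); rewrite /leqif rk eqxx => -[_ /esym].
  by rewrite sub_capmx => /andP[].
(* Here the induction is applied with [L] enlarged to [A + L]. *)
have addL (A : 'M[F]_n) : mx_stable rG C A -> (A <= V)%MS -> ~~ (A <= L)%MS ->
    (V <= A + L)%MS.
  move=> sA sAV nAL; apply: (IHk I (A + L)%MS) => //; first exact: add_stable.
  - exact: submx_trans sTL (addsmxSr _ _).
  - by rewrite addsmx_sub sAV.
  - apply: contra nzLe => /eqP AL0; apply/eqP/sub_kermxP.
    by apply: submx_trans (addsmxSr A L) _; apply/sub_kermxP.
  apply: leq_trans _ (ltk : (_ <= k)%N); rewrite ltn_add2l.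
  have ltr : (\rank L < \rank (A + L)%MS)%N.
    rewrite ltn_neqAle mxrankS ?addsmxSr // andbT.
    apply: contra nAL => /eqP rk.
    have := mxrank_leqif_sup (addsmxSr A L); rewrite /leqif rk eqxx => -[_ /esym].
    by rewrite addsmx_sub => /andP[].
  by rewrite ltn_sub2l // (leq_trans ltr) // rank_leq_col.
have sVIL := addL I' sI' sI'V nI'L.
(* Otherwise [V] is the sum of [I' :&: kermx e] and [L]. By the modular law [I'] is then the sum of
   [I' :&: kermx e] and [I' :&: L], both killed by [e], a contradiction. *)
have sIkL : (I' :&: kermx e <= L)%MS.
  apply: contraR nzIe => nIkL.
  have sVK : (V <= (I' :&: kermx e) + L)%MS.
    apply: addL => //; first exact: cap_stable.
    exact: submx_trans (capmxSl _ _) sI'V.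
  rewrite -I'e; apply/eqP/sub_kermxP.
  have /sub_addsmxP[[a b] /= eI] := submx_trans sI'V sVK.
  have ke : a *m (I' :&: kermx e)%MS *m e = 0.
    apply/sub_kermxP; rewrite (submx_trans (submxMl _ _)) ?capmxSr //.
  apply/sub_kermxP; rewrite eI mulmxDl ke add0r.
  apply/sub_kermxP; apply: submx_trans (_ : (I' :&: L)%MS <= _)%MS; last exact/sub_kermxP.
  rewrite sub_capmx submxMl andbT.
  have -> : b *m L = I' - a *m (I' :&: kermx e)%MS by rewrite {1}eI addrC addKr.
  by rewrite addmx_sub ?eqmx_opp // (submx_trans (submxMl _ _)) ?capmxSl.
(* Since [V] is [I' + L] and [e] is invariant, [[V, C]] lies in [(I' :&: kermx e) + L], hence in
   [L]. As [J] contains the kernel of [e] on [V], this forces [V] into [L]. *)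
have sJL : (J <= L)%MS.
  apply: sJP => // c Cc; have /sub_addsmxP[[a b] /= ->] := sVIL.
  rewrite mulmxDl -!mulmxA addmx_sub //.
    rewrite (submx_trans (submxMl _ _)) // (submx_trans _ sIkL) // sub_capmx.
    rewrite mulmxBr mulmx1 addmx_sub ?eqmx_opp ?sI' //=.
    by apply/sub_kermxP; rewrite mulmxBl -mulmxA eN ?NC // subrr.
  rewrite (submx_trans (submxMl _ _)) // mulmxBr mulmx1 addmx_sub ?eqmx_opp //.
  exact: sL.
case/negP: nVL; apply: (sub_functional (V := V) (e := e)) => //.
apply: submx_trans (ker_sub_J _) sJL; apply: contra nzLe => /eqP Ve0.
by apply/eqP/sub_kermxP; apply: submx_trans sLV _; apply/sub_kermxP.
Qed.
End Representation.
End Indecomposability.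

(** * Conjugation of Brauer trace spaces *)

Section Conjugation.
Set Implicit Arguments. Unset Strict Implicit.
Import GRing.Theory.
Local Open Scope ring_scope.
Variables (F : fieldType) (gT : finGroupType) (G : {group gT}) (n : nat).
Variable rG : mx_representation F G n.
Implicit Type Q : {group gT}.

Lemma brauer_trace_conj_sub Q g : Q \subset G -> g \in G ->
  (brauer_trace_space rG Q *m rG g <= brauer_trace_space rG (Q :^ g)%G)%MS.
Proof.
move=> sQG Gg; rewrite sumsmxMr; apply/sumsmx_subP=> S prSQ.
have sSQ := proper_sub prSQ; have sSG := subset_trans sSQ sQG.
have [sXQ sQX injX _] := rcosets_transversalP sSQ.
set X := transversal _ _ in sXQ sQX injX.
have fixJ : (rfix_mx rG S *m rG g <= rfix_mx rG (S :^ g)%G)%MS.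
  by rewrite rfix_mx_conjsg.
have -> : rfix_mx rG S *m rel_trace_mx rG S Q *m rG g
        = rfix_mx rG S *m rG g *m rel_trace_mx rG (S :^ g) (Q :^ g).
  rewrite (mul_rel_trace_transversal (X := (X :^ g)%g) _ _ fixJ) ?conjSg //.
  - rewrite big_imset /=; last by move=> x y _ _; apply: conjg_inj.
    rewrite mulmx_sumr mulmx_suml; apply: eq_bigr => x Xx.
    have Gx := subsetP sQG x (subsetP sXQ x Xx).
    by rewrite -!mulmxA -!repr_mxM ?groupJ // -conjgC.
  - by rewrite -(conjSg _ _ g^-1) conjsgK (subset_trans sQG) // conjGid ?groupV.
  - by rewrite -conjsMg conjSg.
  - move=> _ _ /imsetP[x Xx ->] /imsetP[y Xy ->]; rewrite !rcosetE -!conjg_set1.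
    rewrite -!conjsMg => /conjsg_inj eq_xy.
    by rewrite (injX x y) // !rcosetE.
apply: rel_trace_sub_brauer fixJ.
by rewrite properE !conjSg.
Qed.

Lemma brauer_trace_conj Q g : Q \subset G -> g \in G ->
  (brauer_trace_space rG Q *m rG g :=: brauer_trace_space rG (Q :^ g)%G)%MS.
Proof.
move=> sQG Gg; apply/eqmxP; rewrite brauer_trace_conj_sub //=.
have sQgG : (Q :^ g)%g \subset G.
  by rewrite -(conjSg _ _ g^-1) conjsgK (subset_trans sQG) // conjGid ?groupV.
have := @brauer_trace_conj_sub (Q :^ g)%G g^-1%g sQgG (groupVr Gg).
have -> : ((Q :^ g) :^ g^-1)%G = Q by apply/val_inj; rewrite /= conjsgK.
by move/(submxMr (rG g)); rewrite repr_mxKV.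
Qed.

End Conjugation.

(** * The permutation module on the right cosets of [P] *)

Section PermutationModule.
Set Implicit Arguments. Unset Strict Implicit.
Import GRing.Theory.
Local Open Scope ring_scope.
Variables (gT : finGroupType) (G P : {group gT}).
Hypothesis sPG : P \subset G.
Let D := rcosets P G.

Lemma sum_rcosets_inv (V : nmodType) (f1 f2 : {set gT} -> V) :
    (forall g, g \in G -> f1 (P :* g)%g = f2 (P :* g^-1)%g) ->
  \sum_(A in D) f1 A = \sum_(A in D) f2 A.
Proof.
(* Inversion permutes the double cosets of P and preserves their sizes, so f1
   and f2 take each value on the same number of cosets. *)
move=> f12.
(* Counting over elements of [G] multiplies each count of cosets by [#|P|] and allows the
   substitution of [g^-1] for [g]. *)
have cntG (f : {set gT} -> V) (a : pred V) :
    (\sum_(g in G) a (f (P :* g)%g) = (\sum_(A in D) a (f A)) * #|P|)%N.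
  rewrite (set_partition_big _ (rcosets_partition sPG)) big_distrl /=.
  apply: eq_bigr => _ /rcosetsP[x Gx ->].
  rewrite (eq_bigr (fun=> nat_of_bool (a (f (P :* x)%g)))); last first.
    by move=> g /rcoset_eqP ->.
  by rewrite sum_nat_const card_rcoset mulnC.
suff pe : perm_eq [seq f1 A | A <- enum D] [seq f2 A | A <- enum D].
  by rewrite -!big_enum /= -(big_map f1 xpredT id) (perm_big _ pe) big_map.
apply/seq.permP=> a.
have cntD (f : {set gT} -> V) :
    count a [seq f A | A <- enum D] = (\sum_(A in D) a (f A))%N.
  rewrite count_map -sum1_count big_mkcond /= big_enum /=.
  by apply: eq_bigr => A _; case: (a _).
apply/eqP; rewrite -(eqn_pmul2r (cardG_gt0 P)) !cntD -!cntG; apply/eqP.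
rewrite [RHS](reindex_inj invg_inj) /=.
by apply: eq_big => [g | g Gg]; rewrite ?groupV // f12.
Qed.

Variable F : fieldType.
Local Notation perm x := (perm_coset_mx F G P x).

Lemma rcosets1_mem : (P : {set gT}) \in D.
Proof. by apply/rcosetsP; exists 1%g; rewrite ?group1 // mulg1. Qed.

Lemma rcosets_rcoset A x : A \in D -> x \in G -> (A :* x)%g \in D.
Proof.
move=> /rcosetsP[y Gy ->] Gx; apply/rcosetsP; exists (y * x)%g.
  exact: groupM.
by rewrite rcosetM.
Qed.

(** Names the matrix row of a coset, so that matrices can be handled as functions on cosets. The
    coset [P] only witnesses that [D] is nonempty; arguments outside [D] get a default index. *)
Definition coset_idx (A : {set gT}) : 'I_#|D| := enum_rank_in rcosets1_mem A.
Local Notation ix := coset_idx.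

Lemma coset_idxK A : A \in D -> enum_val (ix A) = A.
Proof. exact: enum_rankK_in. Qed.

Lemma coset_idx_val i : ix (enum_val i) = i.
Proof. exact: enum_valK_in. Qed.

Lemma row_perm_coset m (Phi : 'M[F]_(#|D|, m)) A x :
  A \in D -> x \in G -> row (ix A) (perm x *m Phi) = row (ix (A :* x)%g) Phi.
Proof.
move=> DA Gx; rewrite row_mul; apply/rowP=> j; rewrite !mxE.
rewrite (bigD1 (ix (A :* x)%g)) //= !mxE !coset_idxK ?rcosets_rcoset // eqxx mul1r.
rewrite big1 ?addr0 // => k nk; rewrite !mxE coset_idxK //.
case: eqP => [e | _]; last by rewrite mul0r.
by rewrite e coset_idx_val eqxx in nk.
Qed.

Lemma perm_coset_hom m (Phi : 'M[F]_(#|D|, m)) (x : gT) (a : 'M[F]_m) :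
    x \in G -> (forall A, A \in D ->
      row (ix (A :* x)%g) Phi = row (ix A) Phi *m a) ->
  perm x *m Phi = Phi *m a.
Proof.
move=> Gx PhiD; apply/row_matrixP=> i.
rewrite -[i]coset_idx_val row_perm_coset ?enum_valP // PhiD ?enum_valP //.
by rewrite row_mul.
Qed.

Lemma mulmx_coset_sum m (u : 'rV[F]_#|D|) (Phi : 'M[F]_(#|D|, m)) :
  u *m Phi = \sum_(A in D) u 0 (ix A) *: row (ix A) Phi.
Proof.
rewrite mulmx_sum_row [RHS]big_enum_val; apply: eq_bigr => i _.
by rewrite coset_idx_val.
Qed.

Lemma perm_coset_fix (u : 'rV[F]_#|D|) A x :
  A \in D -> x \in G -> u *m perm x = u -> u 0 (ix (A :* x)%g) = u 0 (ix A).
Proof.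
move=> DA Gx fixu; rewrite -{1}fixu mxE (bigD1 (ix A)) //=.
rewrite mxE !coset_idxK ?rcosets_rcoset // eqxx mulr1 big1 ?addr0 // => k nk.
rewrite mxE coset_idxK ?rcosets_rcoset //; case: eqP => [e | _]; last by rewrite mulr0.
by rewrite -(rcoset_inj e) coset_idx_val eqxx in nk.
Qed.

Lemma perm_coset_const (x : gT) : x \in G -> perm x *m const_mx 1 = const_mx 1 :> 'cV[F]__.
Proof.
move=> Gx; rewrite -[RHS]mulmx1; apply: perm_coset_hom => // A DA.
by rewrite mulmx1; apply/rowP=> j; rewrite !mxE.
Qed.

(** The coefficients of a [Q]-fixed vector are constant on [Q]-orbits of cosets, and nontrivial
    orbits contribute relative traces. Only the cosets fixed by [Q] remain to be checked. *)
Lemma perm_fix_sub n (rG : mx_representation F G n) (Q : {group gT}) m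
    (u : 'M[F]_(m, #|D|)) (Phi : 'M[F]_(#|D|, n)) (L : 'M[F]_n) :
    Q \subset G ->
    (forall q, q \in Q -> perm q *m Phi = Phi *m rG q) ->
    (forall q, q \in Q -> u *m perm q = u) ->
    (forall A, A \in D -> (forall q, q \in Q -> (A :* q)%g = A) ->
       (row (ix A) Phi <= L)%MS) ->
    (brauer_trace_space rG Q <= L)%MS ->
  (u *m Phi <= L)%MS.
Proof.
move=> sQG PhiQ uQ fixL sTL; apply/row_subP=> i; rewrite row_mul mulmx_coset_sum.
have rowQ q : q \in Q -> row i u *m perm q = row i u by move=> Qq; rewrite -row_mul uQ.
apply: (@sum_equivariant_sub _ _ _ _ rG _ 'Rs%act D Q) => //.
- apply/subsetP=> q Qq; rewrite !inE /=; apply/subsetP=> A DA.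
  by rewrite inE /= rcosetE rcosets_rcoset ?(subsetP sQG).
- move=> A q DA Qq; have Gq := subsetP sQG q Qq.
  rewrite /= rcosetE (perm_coset_fix DA Gq (rowQ q Qq)) -scalemxAl -row_mul.
  by rewrite -PhiQ // row_perm_coset.
- move=> A DA fA; rewrite scalemx_sub // fixL // => q Qq.
  by rewrite -rcosetE fA.
Qed.

End PermutationModule.

(** * The Scott module as a direct summand, and its augmentation *)

Section ScottModule.
Set Implicit Arguments. Unset Strict Implicit.
Import GRing.Theory.
Local Open Scope ring_scope.
Variables (F : fieldType) (gT : finGroupType) (G P : {group gT}) (n : nat).
Variable rG : mx_representation F G n.
Hypothesis sPG : P \subset G.
Local Notation D := (rcosets P G).
Local Notation perm x := (perm_coset_mx F G P x).
Local Notation ix := (coset_idx G P).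
Local Notation ones := (const_mx 1 : 'cV[F]_#|D|).

(** The projection along the complement [W], followed by a partial inverse of [B], splits [B].
    Equivariance is checked on the rows of [B] and of [W], which together span. *)
Lemma scott_retraction : is_scott_module G P rG ->
  exists B : 'M[F]_(n, #|D|), exists B' : 'M[F]_(#|D|, n),
    [/\ B *m B' = 1%:M,
        forall x, x \in G -> B *m perm x = rG x *m B &
        forall x, x \in G -> perm x *m B' = B' *m rG x].
Proof.
case=> [[B [fB homB [W [sW tiBW sBW]]]] _ _].
pose B' := proj_mx <<B>>%MS W *m pinvmx B.
have ti : (<<B>> :&: W)%MS = 0.
  apply/eqP; rewrite -submx0; apply: submx_trans tiBW.
  by rewrite capmxS // genmxE.
have BB' : B *m B' = 1%:M.
  by rewrite mulmxA proj_mx_id ?genmxE // mulmxVp.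
have WB' m (u : 'M_(m, _)) : (u <= W)%MS -> u *m B' = 0.
  by move=> sUW; rewrite mulmxA proj_mx_0 ?mul0mx.
clearbody B'; exists B, B'; split=> // x Gx.
have /submxP[a ea] : (1%:M <= col_mx B W)%MS by rewrite -addsmxE sBW.
rewrite -[LHS]mul1mx -[RHS]mul1mx ea -!mulmxA !mul_col_mx; congr (_ *m col_mx _ _).
  by rewrite !mulmxA homB // -(mulmxA (rG x)) BB' mulmx1 mul1mx.
by rewrite !mulmxA WB' ?sW // WB' // mul0mx.
Qed.

Variables (B : 'M[F]_(n, #|D|)) (B' : 'M[F]_(#|D|, n)).
Hypothesis BB' : B *m B' = 1%:M.
Hypothesis homB : forall x, x \in G -> B *m perm x = rG x *m B.
Hypothesis homB' : forall x, x \in G -> perm x *m B' = B' *m rG x.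

Let e : 'cV[F]_n := B *m ones.

Lemma scott_aug_invariant x : x \in G -> rG x *m e = e.
Proof. by move=> Gx; rewrite mulmxA -homB // -mulmxA perm_coset_const. Qed.

(** The claim says that the row sums of the projection [pi] are 1. Its column sums are 1 because of
    the [G]-fixed vector, and equivariance relates rows to columns. *)
Lemma scott_aug_retraction : rfix_mx rG G != 0 -> B' *m e = ones.
Proof.
move=> nzfix; have [pi piE] : exists pi, pi = B' *m B by exists (B' *m B).
have perm_pi x : x \in G -> perm x *m pi = pi *m perm x.
  by move=> Gx; rewrite piE mulmxA homB' // -mulmxA -homB // mulmxA.
have piD A C x : A \in D -> C \in D -> x \in G ->
    pi (ix (A :* x)%g) (ix (C :* x)%g) = pi (ix A) (ix C).
  move=> DA DC Gx.
  have /rowP/(_ (ix (C :* x)%g)) := row_perm_coset pi DA Gx.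
  rewrite perm_pi // [RHS]mxE => <-; rewrite row_mul.
  rewrite [LHS]mxE (bigD1 (ix C)) //= !mxE !coset_idxK ?rcosets_rcoset // eqxx mulr1.
  rewrite big1 ?addr0 // => k nk; rewrite [perm x _ _]mxE coset_idxK ?rcosets_rcoset //.
  case: eqP => [eq_k | _]; last by rewrite mulr0.
  by rewrite -(rcoset_inj eq_k) coset_idx_val eqxx in nk.
have DP := rcosets1_mem G P.
(* A nonzero [G]-fixed vector of M has all its coordinates in the permutation module equal to some
   nonzero [c], and [pi] fixes it. The coordinate at [P] gives the sum. *)
have colsum : \sum_(A in D) pi (ix A) (ix P) = 1.
  have /rowV0Pn[u sU nzu] := nzfix.
  have uG x : x \in G -> u *m B *m perm x = u *m B.
    by move=> Gx; rewrite -mulmxA homB // mulmxA (rfix_mxP _ sU).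
  pose c := (u *m B) 0 (ix P).
  have uc A : A \in D -> (u *m B) 0 (ix A) = c.
    by case/rcosetsP=> x Gx ->; rewrite (perm_coset_fix DP Gx (uG x Gx)).
  have nzc : c != 0.
    apply: contra nzu => /eqP c0; rewrite -[u]mulmx1 -BB' mulmxA mulmx_coset_sum.
    by rewrite big1 // => A DA; rewrite uc // c0 scale0r.
  have: (u *m B *m pi) 0 (ix P) = c by rewrite piE mulmxA -(mulmxA u) BB' mulmx1.
  rewrite mulmx_coset_sum summxE (eq_bigr (fun A => c * pi (ix A) (ix P))); last first.
    by move=> A DA; rewrite uc // !mxE.
  by rewrite -mulr_sumr -{2}[c]mulr1 => /(mulfI nzc).
(* By equivariance the entry at (P, P g) equals the one at (P g^-1, P), so inversion of
   representatives turns the row of [P] into its column. *)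
have rowsum : \sum_(A in D) pi (ix P) (ix A) = 1.
  rewrite -colsum; apply: sum_rcosets_inv => // g Gg.
  rewrite -(piD P _ g^-1%g) ?groupV //; last by apply: rcosets_rcoset.
  by rewrite -rcosetM mulgV mulg1.
have pi1 x : x \in G -> perm x *m (pi *m ones) = pi *m ones.
  by move=> Gx; rewrite mulmxA perm_pi // -mulmxA perm_coset_const.
rewrite mulmxA -piE; apply/row_matrixP=> i; rewrite -[i]coset_idx_val.
have /rcosetsP[x Gx ->] := enum_valP i.
rewrite -row_perm_coset // pi1 //; apply/rowP=> j.
rewrite row_const !mxE -[RHS]rowsum [RHS]big_enum_val.
by apply: eq_bigr => k _; rewrite coset_idx_val [ones _ _]mxE mulr1.
Qed.

Hypothesis B'e : B' *m e = ones.

Lemma scott_fixed_vector : exists2 v : 'rV_n, (v <= rfix_mx rG P)%MS & v *m e = 1%:M.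
Proof.
exists (row (ix P) B').
  apply/rfix_mxP=> x Px; have Gx := subsetP sPG x Px.
  by rewrite -row_mul -homB' // row_perm_coset ?rcosets1_mem // rcoset_id.
rewrite -row_mul B'e row_const; apply/matrixP=> i j.
by rewrite !ord1 !mxE eqxx.
Qed.

Lemma scott_fix_aug_neq0 (Q : {group gT}) : Q \subset P -> rfix_mx rG Q *m e != 0.
Proof.
move=> sQP; have [v sv ve] := scott_fixed_vector.
apply: contraTneq (oner_neq0 F) => z; rewrite negbK.
have: v *m e = 0.
  by apply/sub_kermxP; apply: submx_trans sv _;
     apply: submx_trans (rfix_mxS rG sQP) _; apply/sub_kermxP.
by rewrite ve => /matrixP/(_ 0 0); rewrite !mxE eqxx => /eqP.
Qed.

(* If l is a P-fixed vector of L with augmentation 1, then Pg |-> l g extends to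
   a G-endomorphism of M preserving the augmentation, hence invertible. *)
Lemma scott_head_local_norm :
    mod_indecomposable rG G ->
  head_local rG 'N_G(P) e (rfix_mx rG P) (brauer_trace_space rG P).
Proof.
move=> indM L sL sTL sLV nzLe.
have [l sl le] := functional_nz_vector nzLe.
have fixl x : x \in P -> l *m rG x = l.
  by move=> Px; apply: (rfix_mxP _ (submx_trans sl sLV)).
(* The choice of [repr] is immaterial because [l] is fixed by [P]. *)
pose Phi : 'M[F]_(#|D|, n) := \matrix_(i < #|D|) (l *m rG (repr (enum_val i))).
have PhiD A g : A \in D -> g \in A -> row (ix A) Phi = l *m rG g.
  move=> DA Ag; rewrite rowK coset_idxK //.
  case/rcosetsP: DA Ag => x Gx -> /rcosetP[a Pa ->].
  case: repr_rcosetP => b Pb; have [Ga Gb] := (subsetP sPG a Pa, subsetP sPG b Pb).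
  by rewrite !repr_mxM // !mulmxA (fixl a) ?(fixl b).
have homPhi x : x \in G -> perm x *m Phi = Phi *m rG x.
  move=> Gx; apply: perm_coset_hom => // A DA.
  case/rcosetsP: (DA) => y Gy eA; have Ay : y \in A by rewrite eA rcoset_refl.
  rewrite (PhiD _ (y * x)%g) ?rcosets_rcoset //; last by rewrite mem_rcoset mulgK.
  by rewrite (PhiD _ y) // repr_mxM // mulmxA.
have Phie : Phi *m e = ones.
  apply/row_matrixP=> i; rewrite -[i]coset_idx_val row_mul.
  have DA := enum_valP i; case/rcosetsP: (DA) => y Gy eA.
  rewrite (PhiD _ y) //; last by rewrite eA rcoset_refl.
  rewrite -mulmxA scott_aug_invariant // le row_const; apply/matrixP=> a b.
  by rewrite !ord1 !mxE eqxx.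
pose a := B *m Phi.
have ca x : x \in G -> a *m rG x = rG x *m a.
  by move=> Gx; rewrite -mulmxA -homPhi // mulmxA homB // mulmxA.
have aXe m : a ^+ m *m e = e.
  elim: m => [|m IHm]; first by rewrite expr0 mul1mx.
  by rewrite exprSr -mulmxE -mulmxA -(mulmxA B) Phie.
have nze : e != 0.
  by have:= scott_fix_aug_neq0 (subxx P); apply: contraNneq => ->; rewrite mulmx0.
have ua : a \in unitmx.
  apply: (fitting indM ca) => m; apply: contraNneq nze => z.
  by rewrite -(aXe m) z mul0mx.
(* Every [P]-fixed vector is the image under [a] of a [P]-fixed vector, hence the image under [Phi]
   of a [P]-fixed vector of the permutation module. *)
rewrite -[rfix_mx rG P](mulmxKV ua); set V := rfix_mx rG P *m invmx a.
have fixV : (V <= rfix_mx rG P)%MS.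
  apply/rfix_mxP=> x Px; have Gx := subsetP sPG x Px.
  have Va : V *m a = rfix_mx rG P by apply: mulmxKV.
  by rewrite -[LHS](mulmxK ua) -(mulmxA V) -ca // mulmxA Va rfix_mx_id.
rewrite mulmxA; apply: (perm_fix_sub (rG := rG) (Q := P)) => //.
- by move=> q Pq; rewrite homPhi // (subsetP sPG).
- move=> q Pq; rewrite -mulmxA homB ?(subsetP sPG) // mulmxA.
  by rewrite (rfix_mxP _ fixV).
move=> A DA fA; case/rcosetsP: (DA) => y Gy eA.
rewrite (PhiD _ y) //; last by rewrite eA rcoset_refl.
(* A coset [P :* y] fixed by [P] has [y] normalising [P]; its image [l *m rG y] then lies in [L] by
   stability. *)
have Ny : y \in 'N_G(P).
  rewrite inE Gy -groupV inE; apply/subsetP=> _ /imsetP[q Pq ->].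
  have: (y * q)%g \in A by rewrite -(fA q Pq) eA mem_rcoset mulgK rcoset_refl.
  by rewrite eA mem_rcoset conjgE invgK mulgA.
exact: submx_trans (submxMr _ sl) (sL y Ny).
Qed.

Variable p : nat.
Hypothesis pF : p \in [pchar F].

(** The projection [E] onto the [T]-fixed cosets induces an endomorphism [a] of M over ['N_G(T)]. It
    preserves the augmentation of [T]-fixed vectors, so it is not nilpotent and, by Fitting's lemma,
    it is invertible. Since [a] absorbs the action of [T], that action is trivial. *)
Lemma scott_indecomposable_rker (T : {group gT}) :
    T \subset P -> p.-group T -> mod_indecomposable rG 'C_G(T) ->
  T \subset rker rG.
Proof.
move=> sTP pT indT; have sTG := subset_trans sTP sPG.
pose fixT (A : {set gT}) := [forall q in T, A :* q == A]%g.
pose E : 'M[F]_#|D| := diag_mx (\row_i (fixT (enum_val i))%:R).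
have rowE A : A \in D -> row (ix A) E = (fixT A)%:R *: row (ix A) 1%:M.
  move=> DA; apply/rowP=> j; rewrite !mxE coset_idxK //.
  by rewrite mulr_natr.
have fixTN A x : x \in 'N_G(T) -> fixT (A :* x)%g = fixT A.
  move=> Nx.
  have sub C y : y \in 'N_G(T) -> fixT C -> fixT (C :* y)%g.
    case/setIP=> _ /normP NTy /forall_inP fC; apply/forall_inP=> q.
    rewrite -NTy => /imsetP[t Tt ->]; apply/eqP.
    by rewrite -rcosetM -conjgC rcosetM (eqP (fC t Tt)).
  apply/idP/idP; last exact: sub.
  by move/(sub _ x^-1%g); rewrite groupV rcosetK; apply.
have cE x : x \in 'N_G(T) -> perm x *m E = E *m perm x.
  move=> Nx; have Gx : x \in G by case/setIP: Nx.
  apply: perm_coset_hom => // A DA; rewrite !rowE ?rcosets_rcoset // fixTN //.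
  by rewrite -scalemxAl -row_mul mul1mx -[perm x]mulmx1 row_perm_coset.
have NT t : t \in T -> t \in 'N_G(T).
  by move=> Tt; rewrite inE (subsetP sTG) // (subsetP (normG T)).
have ET t : t \in T -> E *m perm t = E.
  move=> Tt; have Gt := subsetP sTG t Tt; rewrite -cE ?NT // -[RHS]mulmx1.
  apply: perm_coset_hom => // A DA; rewrite mulmx1 !rowE ?rcosets_rcoset //.
  rewrite fixTN ?NT //; case fA: (fixT A); last by rewrite !scale0r.
  by rewrite (eqP (forall_inP fA t Tt)).
pose a := B *m E *m B'.
have ca x : x \in 'N_G(T) -> a *m rG x = rG x *m a.
  move=> Nx; have Gx : x \in G by case/setIP: Nx.
  by rewrite /a -mulmxA -homB' // !mulmxA -homB // -(mulmxA B (perm x)) cE // !mulmxA.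
have [v0 sv0 v0e] := scott_fixed_vector.
have vX m : (v0 *m a ^+ m <= rfix_mx rG T)%MS /\ v0 *m a ^+ m *m e = 1%:M.
  elim: m => [|m [fixv ve]].
    by rewrite expr0 mulmx1 (submx_trans sv0) ?rfix_mxS.
  rewrite exprSr -mulmxE mulmxA; set v := v0 *m _ in fixv ve *.
  split.
    apply/rfix_mxP=> t Tt; rewrite -mulmxA ca ?NT // mulmxA.
    by rewrite (rfix_mxP _ fixv).
  (* The difference of [v] and [v *m a] comes from cosets not fixed by [T], so it is a sum of traces
     from proper subgroups, which [e] kills. *)
  suff: v *m B *m ((1%:M - E) *m B') *m e = 0.
    have -> : v *m B *m ((1%:M - E) *m B') = v - v *m a.
      by rewrite mulmxBl mul1mx mulmxBr -(mulmxA v B B') BB' mulmx1 /a !mulmxA.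
    by rewrite mulmxBl ve => /eqP; rewrite subr_eq0 => /eqP <-.
  apply/sub_kermxP; apply: (perm_fix_sub (rG := rG) (Q := T)) => //.
  - move=> q Tq; have Gq := subsetP sTG q Tq.
    by rewrite !mulmxA mulmxBr mulmx1 cE ?NT // -{1}[perm q]mul1mx -mulmxBl -!mulmxA homB'.
  - move=> q Tq; rewrite -mulmxA homB ?(subsetP sTG) // mulmxA.
    by rewrite (rfix_mxP _ fixv).
  - move=> A DA fA; rewrite row_mul linearB /= rowE //.
    have -> : fixT A by apply/forall_inP=> q /fA/eqP.
    by rewrite scale1r subrr mul0mx sub0mx.
  apply/sub_kermxP; apply: (brauer_trace_invariant pF pT) => x Tx.
  by rewrite scott_aug_invariant // (subsetP sTG).
have ua : a \in unitmx.
  apply: (fitting indT) => [x /setIP[Gx Cx] | m].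
    by apply: ca; rewrite inE Gx (subsetP (cent_sub T)).
  apply: contraTneq (oner_neq0 F) => z; rewrite negbK.
  have [_ ] := vX m; rewrite z mulmx0 mul0mx => /matrixP/(_ 0 0).
  by rewrite !mxE eqxx => /eqP; rewrite eq_sym.
apply/subsetP=> t Tt; apply/rkerP; have Gt := subsetP sTG t Tt; split=> //.
have at1 : a *m rG t = a.
  by rewrite /a -mulmxA -homB' // mulmxA -(mulmxA B) ET.
by rewrite -[LHS](mulmxK ua) -ca ?NT // at1 mulmxV.
Qed.

End ScottModule.

(** * Saturation and the index of P C_G(P) in N_G(P) *)

Section Saturation.
Set Implicit Arguments. Unset Strict Implicit.
Variables (gT : finGroupType) (G P : {group gT}) (p : nat).

(** The only conjugate of [P] inside [P] is [P], so [P] is fully normalized and its image is a Sylow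
    p-subgroup of [AutF G P]. The kernel of the conjugation map lies in [P <*> 'C_G(P)], so the
    index can be read off in [AutF G P]. *)
Lemma saturated_index :
    P \subset G -> prime p -> saturated_fusion p G P ->
  ~~ (p %| #|'N_G(P) : P <*> 'C_G(P)|)%N.
Proof.
move=> sPG p_pr [/(_ P (subxx P)) satP _].
have [|_ sylP] := satP.
  move=> g Gg sPgP; suff -> : P :^ g = P by [].
  by apply/eqP; rewrite eqEcard sPgP cardJg /=.
have sNN : 'N_G(P) \subset 'N(P) by apply: subsetIr.
have sPN : P \subset 'N_G(P) by rewrite subsetI sPG normG.
have sCN : P <*> 'C_G(P) \subset 'N_G(P) by rewrite join_subG sPN subcent_sub.
have kerE : #|'ker_('N_G(P)) (conj_aut P) : P <*> 'C_G(P)| = 1%N.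
  apply/eqP; rewrite indexg_eq1; apply/subsetP=> x /setIP[/setIP[Gx _] kx].
  rewrite (subsetP (joing_subr _ _)) // inE Gx.
  by rewrite -ker_conj_aut.
rewrite -(index_morphim_ker (conj_aut P) sCN sNN) kerE muln1 -p'natE //.
case/and3P: sylP => _ _; apply: pnat_dvd; rewrite /AutF /AutP.
have -> : 'N_P(P) = P by apply/setIidPl; apply: normG.
by apply: indexgS; apply: morphimS; apply: joing_subl.
Qed.
End Saturation.

(** * The core of [P], and Brauer indecomposability of the Scott module *)

Section MainArgument.
Set Implicit Arguments. Unset Strict Implicit.
Import GRing.Theory.
Local Open Scope ring_scope.
Variables (F : fieldType) (p : nat) (gT : finGroupType) (G P : {group gT}) (n : nat).
Variable rG : mx_representation F G n.
Hypotheses (pF : p \in [pchar F]) (sPG : P \subset G) (pP : p.-group P).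
Hypothesis scottM : is_scott_module G P rG.

(** An element of all conjugates of [P] fixes every coset of [P], so it acts trivially on the
    permutation module and on its summand M. *)
Lemma core_sub_rker : \bigcap_(x in G) P :^ x \subset P :&: rker rG.
Proof.
have [B [B' [BB' homB homB']]] := scott_retraction scottM.
apply/subsetP=> x /bigcapP cx.
have Px : x \in P by have:= cx 1%g (group1 G); rewrite conjsg1.
have Gx := subsetP sPG x Px; rewrite inE Px /=; apply/rkerP; split=> //.
have px1 : perm_coset_mx F G P x = 1%:M.
  rewrite -[LHS]mulmx1 -[RHS]mulmx1; apply: perm_coset_hom => // A.
  case/rcosetsP=> y Gy ->; rewrite mulmx1; congr (row (coset_idx _ _ _) _).
  rewrite -rcosetM; apply/rcoset_eqP; rewrite mem_rcoset.
  by have:= cx y Gy; rewrite mem_conjg conjgE invgK mulgA.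
by rewrite -[LHS]mulmx1 -BB' mulmxA -homB // px1 mulmx1.
Qed.

Hypothesis p'NC : ~~ (p %| #|'N_G(P) : P <*> 'C_G(P)|)%N.

Section Retraction.
Variables (B : 'M[F]_(n, #|rcosets P G|)) (B' : 'M[F]_(#|rcosets P G|, n)).
Hypothesis BB' : B *m B' = 1%:M.
Hypothesis homB : forall x, x \in G -> B *m perm_coset_mx F G P x = rG x *m B.
Hypothesis homB' : forall x, x \in G -> perm_coset_mx F G P x *m B' = B' *m rG x.
Let e : 'cV[F]_n := B *m const_mx 1.

Let B'e : B' *m e = const_mx 1.
Proof. by case: scottM => _ _; apply: scott_aug_retraction. Qed.

Let eG x : x \in G -> rG x *m e = e.
Proof. exact: scott_aug_invariant. Qed.

Let Te0 (Q : {group gT}) : Q \subset P -> brauer_trace_space rG Q *m e = 0.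
Proof.
move=> sQP; apply: (brauer_trace_invariant pF (pgroupS sQP pP)) => x Qx.
by rewrite eG // (subsetP sPG) // (subsetP sQP).
Qed.

(** The property over ['N_G(P)] descends to the normal subgroup [P <*> 'C_G(P)] of index prime to p,
    and then to ['C_G(P)] because [P] fixes every vector of M^P. *)
Lemma scott_head_local_cent :
  head_local rG 'C_G(P) e (rfix_mx rG P) (brauer_trace_space rG P).
Proof.
have nPN : P <| 'N_G(P) by rewrite normalSG.
have nCN : (P <*> 'C_G(P))%G <| 'N_G(P).
  by rewrite normalY // /normal subcent_sub subcent_norm.
have sNG : 'N_G(P) \subset G by apply: subsetIl.
have conjP x : x \in 'N_G(P) -> (P :^ x)%G = P.
  by case/setIP=> _ /normP e'; apply/val_inj.
have hlC : head_local rG (P <*> 'C_G(P))%G e (rfix_mx rG P) (brauer_trace_space rG P).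
  apply: (head_local_normal sNG nCN) => [|x Nx|x Nx||||].
  - by rewrite -(dvdn_pcharf pF).
  - by rewrite -rfix_mx_conjsg ?(subsetP sNG) // -[X in rfix_mx rG X]/(val (P :^ x)%G) conjP.
  - have := brauer_trace_conj_sub rG sPG (subsetP sNG x Nx).
    by rewrite conjP.
  - exact: brauer_trace_fix.
  - by move=> x Nx; rewrite eG // (subsetP sNG).
  - exact: Te0.
  - by case: scottM => _ indM _; exact: (scott_head_local_norm sPG homB homB' B'e indM).
move=> L sL sTL sLV; apply: hlC => // x.
rewrite /= norm_joinEr; last by rewrite (subset_trans _ (cent_sub P)) ?subsetIr.
case/mulsgP=> q c Pq Cc ->; have [Gc _] := setIP Cc.
rewrite repr_mxM ?(subsetP sPG q Pq) // mulmxA ((rfix_mxP _ sLV) q Pq).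
exact: sL.
Qed.

Lemma scott_brauer_subgroup (R Q : {group gT}) :
    R \subset P :&: rker rG ->
    (forall T : {group gT}, R \subset T -> maximal T P ->
       mod_indecomposable rG 'C_G(T)) ->
    Q \subset P ->
  subquot_indecomposable rG (Q * 'C_G(Q))%g (rfix_mx rG Q) (brauer_trace_space rG Q).
Proof.
rewrite subsetI => /andP[sRP kR] indT sQP.
have pQ := pgroupS sQP pP; have sQG := subset_trans sQP sPG.
have sCQ (T : {group gT}) : Q \subset T -> 'C_G(T) \subset (Q * 'C_G(Q))%g.
  move=> sQT; rewrite (subset_trans _ (mulG_subr _ _)) //.
  by rewrite setIS ?centS.
(* Under these inclusions M(Q) is a quotient of M(P), and it inherits the unique maximal submodule
   over ['C_G(P)]. *)
have viaP : (rfix_mx rG Q <= rfix_mx rG P)%MS ->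
    (brauer_trace_space rG P <= brauer_trace_space rG Q)%MS ->
    subquot_indecomposable rG (Q * 'C_G(Q))%g (rfix_mx rG Q) (brauer_trace_space rG Q).
  move=> sVQP sTPQ.
  apply: (head_local_indecomposable (e := e)); first exact: Te0.
    exact: (scott_fix_aug_neq0 sPG homB' B'e sQP).
  move=> L sL sTL sLV nzL; apply: (submx_trans sVQP).
  apply: (sub_head_local (sCQ P sQP) sTPQ scott_head_local_cent) => //.
  exact: submx_trans sLV sVQP.
(* This case includes [R] equal to [P], where no maximal subgroup of [P] contains [R]. *)
have [kP | nkP] := boolP (P \subset rker rG).
  by apply: viaP; rewrite ?rfix_rker // (brauer_trace_rker pF pP kP) sub0mx.
have [eRP | [T maxT sRT]] := maximal_exists sRP.
  by case/negP: nkP; rewrite -eRP.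
have sTP := proper_sub (maxgroupp maxT); have indCT := indT T sRT maxT.
have kT : T \subset rker rG.
  exact: (scott_indecomposable_rker sPG BB' homB homB' B'e pF sTP (pgroupS sTP pP)).
(* Inside [T], M(Q) is M, indecomposable already over ['C_G(T)]. Otherwise P = T Q with [T] acting
   trivially, so M^Q is M^P. *)
have [sQT | nQT] := boolP (Q \subset T).
  have kQ := subset_trans sQT kT; rewrite (brauer_trace_rker pF pQ kQ).
  apply: (eqmx_subquot_indecomposable (V := 1%:M) (T := 0)) => //.
    by apply/eqmxP; rewrite submx1 rfix_rker.
  exact: sub_subquot_indecomposable (sCQ T sQT) indCT.
apply: viaP; last exact: (brauer_trace_maximal pF sPG pP maxT kT sQP nQT).
apply/rfix_mxP=> x; rewrite (maximal_mulg pP maxT sQP nQT) => /mulsgP[t q Tt Qq ->].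
have [Gt t1] := rkerP (subsetP kT t Tt).
by rewrite repr_mxM ?(subsetP sQG q Qq) // t1 mul1mx rfix_mx_id.
Qed.
End Retraction.

Lemma scott_brauer_indecomposable (R : {group gT}) :
    R \subset P :&: rker rG ->
    (forall T : {group gT}, R \subset T -> maximal T P ->
       mod_indecomposable rG 'C_G(T)) ->
  brauer_indecomposable rG p.
Proof.
move=> sR indT Q sQG pQ.
have [B [B' [BB' homB homB']]] := scott_retraction scottM.
have [/exists_inP[g Gg sQgP] | nQP] := boolP [exists g in G, Q :^ g \subset P]%g.
  right; have Gg' := groupVr Gg.
  have sQgG := subset_trans sQgP sPG.
  have indQg := scott_brauer_subgroup BB' homB homB' (Q := (Q :^ g)%G) sR indT sQgP.
  have sHG : ((Q :^ g) * 'C_G(Q :^ g))%g \subset G by rewrite mul_subG ?subsetIl.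
  have := subquot_indecomposable_conj Gg' sHG indQg.
  have -> : (((Q :^ g) * 'C_G(Q :^ g)) :^ g^-1 = Q * 'C_G(Q))%g.
    by rewrite conjsMg conjIg -centJ conjsgK conjGid.
  apply: eqmx_subquot_indecomposable.
    by apply: eqmx_trans (eqmx_sym (rfix_mx_conjsg _ _ _)) _; rewrite ?conjsgK.
  apply: eqmx_trans (brauer_trace_conj _ _ _) _ => //.
  by have -> : ((Q :^ g) :^ g^-1)%G = Q by apply/val_inj; rewrite /= conjsgK.
(* If no conjugate of [Q] lies in [P], then [Q] fixes no coset of [P], so M^Q consists of relative
   traces and M(Q) is zero. *)
left; rewrite -[rfix_mx rG Q]mulmx1 -BB' mulmxA.
apply: (perm_fix_sub (rG := rG) (Q := Q)) => //.
- by move=> q Qq; rewrite homB' // (subsetP sQG).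
- by move=> q Qq; rewrite -mulmxA homB ?(subsetP sQG) // mulmxA rfix_mx_id.
move=> A /rcosetsP[y Gy ->] fA; case/exists_inP: nQP; exists y^-1%g; rewrite ?groupV //.
apply/subsetP=> _ /imsetP[q Qq ->].
have: (y * q)%g \in (P :* y)%g by rewrite -(fA q Qq) mem_rcoset mulgK rcoset_refl.
by rewrite mem_rcoset conjgE invgK mulgA.
Qed.
End MainArgument.

Theorem theorem1p3 (F : closedFieldType) (p : nat) (gT : finGroupType)
    (G P : {group gT}) (n : nat) (rG : mx_representation F G n) :
  (p \in [pchar F])%R ->
  P \subset G -> p.-group P ->
  is_scott_module G P rG ->
  saturated_fusion p G P ->
  [/\ forall R : {group gT}, R <| G -> R \subset P :&: rker rG ->
        (forall T : {group gT}, R \subset T -> maximal T P ->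
           mod_indecomposable rG 'C_G(T)) ->
        brauer_indecomposable rG p,
      \bigcap_(x in G) P :^ x \subset P :&: rker rG &
      forall R : {group gT}, R <| G -> R \subset P :&: rker rG ->
        R \subset \bigcap_(x in G) P :^ x].
Proof.
move=> pF sPG pP scottM satP; split.
- move=> R _; apply: scott_brauer_indecomposable => //.
  exact: saturated_index sPG (GRing.pcharf_prime pF) satP.
- exact: core_sub_rker.
move=> R /andP[_ nRG]; rewrite subsetI => /andP[sRP _].
apply/bigcapsP=> x Gx; rewrite -(normP (subsetP nRG x Gx)).
by rewrite conjSg.
Qed.
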